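(* Let $\hbar\in\mathbb{C}\setminus\{0\}$, $h=2i\hbar$, and let $\mathcal{A}=\big(U(su(2)_h)\otimes\mathbb{C}[t,r_\hbar]\big)/\langle x^2+y^2+z^2+\hbar^2-r_\hbar^2\rangle$ with skew-field of fractions $\mathcal{B}$. Let $\mathrm{D}$ be the multiplicative $2\times 2$ matrix map of quantum partial derivatives on $\mathcal{A}$. Let $\vec\alpha=(\alpha_1,\alpha_2,\alpha_3)\in\mathbb{C}^3$ with $\alpha_1^2+\alpha_2^2+\alpha_3^2=1$, $b=\alpha_1x+\alpha_2y+\alpha_3z$ and $c=r_\hbar-b$. Then the matrix $\mathrm{D}(c)=\mathrm{D}(r_\hbar)-\mathrm{D}(b)$ is invertible over $\mathcal{B}$, with $$\mathrm{D}(c)^{-1}=I\,a_0+\mathrm{D}(r_\hbar)\,a_1+\mathrm{D}(b)\,a_2+\mathrm{D}(r_\hbar)\mathrm{D}(b)\,a_3,$$ where $$a_0=\frac{2(r_\hbar^2+b^2-3br_\hbar-\hbar^2)}{(r_\hbar-b)((r_\hbar-b)^2-4\hbar^2)},\qquad a_1=\frac{3b-r_\hbar}{(r_\hbar-b)((r_\hbar-b)^2-4\hbar^2)},$$ $$a_2=\frac{3r_\hbar-b}{(r_\hbar-b)((r_\hbar-b)^2-4\hbar^2)},\qquad a_3=\frac{-2}{(r_\hbar-b)((r_\hbar-b)^2-4\hbar^2)}.$$ Consequently, if the quantum partial derivatives are extended to $c^{-1}$ by setting $\mathrm{D}(c^{-1})=\mathrm{D}(c)^{-1}$, then $$\partial_t\Big(\frac1{r_\hbar-b}\Big)=\frac{-i\hbar}{r_\hbar\,((r_\hbar-b)^2-4\hbar^2)},$$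 $$\vec\nabla\Big(\frac1{r_\hbar-b}\Big)=\frac{r_\hbar\vec\alpha-\vec r_\hbar}{r_\hbar}\,\frac1{(r_\hbar-b)^2-4\hbar^2}-\big(\hbar\,\vec\alpha+i[\vec r_\hbar\times\vec\alpha]\big)\frac{2\hbar}{r_\hbar(r_\hbar-b)((r_\hbar-b)^2-4\hbar^2)},$$ where the order of the factors is as written.
   Context: $U(su(2)_h)$ is the unital associative $\mathbb{C}$-algebra generated by $x,y,z$ with relations $[x,y]=hz$, $[y,z]=hx$, $[z,x]=hy$. In $\mathcal{A}$ the elements $t$ and $r_\hbar$ (the quantum radius) are central. $\mathcal{B}=\mathcal{A}[\mathcal{A}^{-1}]$ is the skew-field of fractions of $\mathcal{A}$. All fractions above have mutually commuting numerator and denominator. Notation: $\vec r_\hbar=(x,y,z)$, $\vec\nabla=(\partial_x,\partial_y,\partial_z)$, and $[\cdot\times\cdot]$ is the usual vector product; the components of $\vec r_\hbar$ do not commute with $r_\hbar-b$ in general. The map $\mathrm{D}$ is the unital algebra homomorphism from $\mathcal{A}$ to $2\times2$ matrices over $\mathcal{A}[r_\hbar^{-1}]\subset\mathcal{B}$ given by $\mathrm{D}(t)=(t+i\hbar)I$ and $$\mathrm{D}(x)=\begin{pmatrix}x&-\hbar\\-\hbar&x\end{pmatrix},\quad \mathrm{D}(y)=\begin{pmatrix}y&-i\hbar\\i\hbar&y\end{pmatrix},\quad \mathrm{D}(z)=\begin{pmatrix}z-\hbar&0\\0&z+\hbar\end{pmatrix},$$ $$\mathrm{D}(r_\hbar)=\frac1{r_\hbar}\begin{pmatrix}r_\hbar^2+\hbar^2-\hbar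 z&-\hbar(x+iy)\\-\hbar(x-iy)&r_\hbar^2+\hbar^2+\hbar z\end{pmatrix}.$$ The quantum partial derivatives $\partial_t,\partial_x,\partial_y,\partial_z$ of an element $a$ are read off from $\mathrm{D}(a)$ by $$\mathrm{D}(a)=i\hbar\begin{pmatrix}\hat\partial_ta+i\partial_za&i\partial_xa-\partial_ya\\ i\partial_xa+\partial_ya&\hat\partial_ta-i\partial_za\end{pmatrix},\qquad \hat\partial_t=\partial_t+\frac2h\,\mathrm{id}.$$ *)

(* Defs.v *)
From HB Require Import structures.
From mathcomp Require Import all_boot all_order all_algebra.
From mathcomp Require Import boolp finmap generic_quotient ring_quotient monalg.

Set Implicit Arguments.
Unset Strict Implicit.
Unset Printing Implicit Defensive.
Import Order.TTheory GRing.Theory Num.Theory.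
Local Open Scope ring_scope.
Local Open Scope quotient_scope.

Section MonoidAlgebra.
Variables (K : comNzRingType) (M : monomType).

Lemma malg_scalerAr (k : K) (p q : {malg K[M]}) : k *: (p * q) = p * (k *: q).
Proof.
rewrite [p * q]malgME [RHS](malgMEw (fsubset_refl _) (msuppZ_le k q)).
rewrite scaler_sumr; apply: eq_bigr => a _.
rewrite scaler_sumr; apply: eq_bigr => b _.
by rewrite mcoeffZ mulrCA; apply/malgP => c; rewrite mcoeffZ !mcoeffU mulrnAr.
Qed.
End MonoidAlgebra.

Inductive two_sided_ideal (F : nzRingType) (S : seq F) : F -> Prop :=
| TSI_0 : two_sided_ideal S 0
| TSI_D u v :
    two_sided_ideal S u -> two_sided_ideal S v -> two_sided_ideal S (u + v)
| TSI_M a s b : s \in S -> two_sided_ideal S (a * s * b).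

Definition tsi_pred (F : nzRingType) (S : seq F) : {pred F} :=
  [pred p | `[< two_sided_ideal S p >]].

Section TwoSidedIdealTheory.
Variables (F : nzRingType) (S : seq F).

Lemma tsiN u : two_sided_ideal S u -> two_sided_ideal S (- u).
Proof.
elim=> [|v w _ IHv _ IHw|a s b sS]; first by rewrite oppr0; exact: TSI_0.
  by rewrite opprD; exact: TSI_D.
by rewrite -!mulNr; exact: TSI_M.
Qed.

Lemma tsiMl a u : two_sided_ideal S u -> two_sided_ideal S (a * u).
Proof.
elim=> [|v w _ IHv _ IHw|b s c sS]; first by rewrite mulr0; exact: TSI_0.
  by rewrite mulrDr; exact: TSI_D.
by rewrite !mulrA; exact: TSI_M.
Qed.

Lemma tsiMr a u : two_sided_ideal S u -> two_sided_ideal S (u * a).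
Proof.
elim=> [|v w _ IHv _ IHw|b s c sS]; first by rewrite mul0r; exact: TSI_0.
  by rewrite mulrDl; exact: TSI_D.
by rewrite -!mulrA [b * _]mulrA; exact: TSI_M.
Qed.

Lemma tsi_zmod_closed : zmod_closed (tsi_pred S).
Proof.
split=> [|u v]; rewrite !inE; first by apply/asboolP; exact: TSI_0.
move=> /asboolP Su /asboolP Sv; apply/asboolP.
by apply: TSI_D => //; exact: tsiN.
Qed.

HB.instance Definition _ :=
  GRing.isZmodClosed.Build F (tsi_pred S) tsi_zmod_closed.

Lemma tsi_gen s : s \in S -> two_sided_ideal S s.
Proof. by move=> sS; rewrite -[s]mul1r -[_ * s]mulr1; exact: TSI_M. Qed.
End TwoSidedIdealTheory.

Section Presentation.
Variable C : numClosedFieldType.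

(* The maps fgen and qpi are locked, since conversion on their bodies is very
   slow. *)
Fact fgen_key : unit. Proof. exact: tt. Qed.
Fact qpi_key : unit. Proof. exact: tt. Qed.

(* The free unital associative C-algebra on five generators. *)
Definition freeA := {malg C[{fmonom 'I_5}]}.
HB.instance Definition _ := GRing.Lalgebra.on freeA.

Definition fgen (i : 'I_5) : freeA := locked_with fgen_key << fmu i >>.
Definition fx := fgen (@Ordinal 5 0 isT).
Definition fy := fgen (@Ordinal 5 1 isT).
Definition fz := fgen (@Ordinal 5 2 isT).
Definition ft := fgen (@Ordinal 5 3 isT).
Definition fr := fgen (@Ordinal 5 4 isT).

Definition comm_br (F : nzRingType) (u v : F) := u * v - v * u.

Definition hpar (hb : C) : C := 2 * 'i * hb.

(* The first three relators present U(su(2)_h); adding t and r, commuting with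
   x, y, z and with each other, presents U(su(2)_h) (x) C[t, r]. *)
Definition suq_relators (F : lalgType C) (hb : C) (x y z t r : F) : seq F :=
  [:: comm_br x y - hpar hb *: z; comm_br y z - hpar hb *: x;
      comm_br z x - hpar hb *: y;
      comm_br t x; comm_br t y; comm_br t z;
      comm_br r x; comm_br r y; comm_br r z; comm_br t r;
      x ^+ 2 + y ^+ 2 + z ^+ 2 + (hb ^+ 2)%:A - r ^+ 2].

Lemma suq_relators_kill (F : lalgType C) (ev : {rmorphism F -> C}) hb x y z t r :
    (forall k p, ev (k *: p) = k * ev p) ->
    ev x = 0 -> ev y = 0 -> ev z = 0 -> ev r = hb ->
  forall s, s \in suq_relators hb x y z t r -> ev s = 0.
Proof.
move=> evZ evx evy evz evr s.
have ev_br u v : ev (comm_br u v) = 0.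
  by rewrite /comm_br rmorphB 2!rmorphM mulrC subrr.
have ev_su2 u v w : ev w = 0 -> ev (comm_br u v - hpar hb *: w) = 0.
  by move=> w0; rewrite rmorphB ev_br evZ w0 mulr0 subrr.
have ev_cas : ev (x ^+ 2 + y ^+ 2 + z ^+ 2 + (hb ^+ 2)%:A - r ^+ 2) = 0.
  rewrite rmorphB 3!rmorphD 4!rmorphXn evZ rmorph1 evx evy evz evr.
  by rewrite expr0n !add0r mulr1 subrr.
rewrite /suq_relators 10!in_cons mem_seq1.
do 3![case/orP=> [/eqP->|]; first exact: ev_su2].
by do 7![case/orP=> [/eqP->|]; first exact: ev_br]; move/eqP->.
Qed.

Lemma map_suq_relators (F G : lalgType C) (f : {lrmorphism F -> G}) hb x y z t r :
  map f (suq_relators hb x y z t r)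
  = suq_relators hb (f x) (f y) (f z) (f t) (f r).
Proof.
have f_br u v : f (comm_br u v) = comm_br (f u) (f v).
  by rewrite /comm_br rmorphB 2!rmorphM.
have f_su2 u v w : f (comm_br u v - hpar hb *: w)
                 = comm_br (f u) (f v) - hpar hb *: f w.
  by rewrite linearB linearZ /= f_br.
have f_cas : f (x ^+ 2 + y ^+ 2 + z ^+ 2 + (hb ^+ 2)%:A - r ^+ 2)
    = f x ^+ 2 + f y ^+ 2 + f z ^+ 2 + (hb ^+ 2)%:A - f r ^+ 2.
  by rewrite linearB 3!linearD linearZ /= 4!rmorphXn rmorph1.
by rewrite /suq_relators !map_cons 3!f_su2 7!f_br f_cas.
Qed.

Lemma suq_relatorsP (F : lalgType C) hb (x y z t r : F) :
    (forall s, s \in suq_relators hb x y z t r -> s = 0) ->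
  [/\ [/\ comm_br x y = hpar hb *: z, comm_br y z = hpar hb *: x
         & comm_br z x = hpar hb *: y],
      [/\ t * x = x * t, t * y = y * t, t * z = z * t & t * r = r * t],
      [/\ r * x = x * r, r * y = y * r & r * z = z * r]
    & x ^+ 2 + y ^+ 2 + z ^+ 2 + (hb ^+ 2)%:A = r ^+ 2].
Proof.
move=> rel0; have rel i : (i < 11)%N -> (suq_relators hb x y z t r)`_i = 0.
  by move=> lt_i; apply: rel0; exact: mem_nth.
split; last by apply/subr0_eq; exact: (rel 10%N).
- split; apply/subr0_eq; [exact: (rel 0%N)|exact: (rel 1%N)|exact: (rel 2%N)].
- split; apply/subr0_eq;
    [exact: (rel 3%N)|exact: (rel 4%N)|exact: (rel 5%N)|exact: (rel 9%N)].
- split; apply/subr0_eq; [exact: (rel 6%N)|exact: (rel 7%N)|exact: (rel 8%N)].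
Qed.

Definition relators (hb : C) : seq freeA := suq_relators hb fx fy fz ft fr.

(* Evaluation of the free algebra at a point of C^5; at (0, 0, 0, 0, hb) it
   kills the relators, so that the quotient below is not trivial. *)
Section Eval.
Variable e : 'I_5 -> C.

Definition evalw (m : {fmonom 'I_5}) : C := \prod_(i <- (m : seq _)) e i.

Lemma evalw1 : evalw mone = 1.
Proof. by rewrite /evalw fm1 big_nil. Qed.

Lemma evalwM : {morph evalw : m n / mmul m n >-> m * n}.
Proof. by move=> m n; rewrite /evalw fmM big_cat. Qed.

HB.instance Definition _ := isMultiplicative.Build {fmonom 'I_5} C evalw
  (evalwM, evalw1).

Lemma evalU i : mmap idfun evalw (fgen i) = e i.
Proof. by rewrite /fgen unlock mmapU mul1r /evalw fmU big_seq1. Qed.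
End Eval.

Lemma tsi_proper hb : ~ two_sided_ideal (relators hb) 1.
Proof.
pose e (i : 'I_5) : C := if val i == 4%N then hb else 0.
pose ev : {rmorphism freeA -> C} := mmap idfun (evalw e).
have evZ k p : ev (k *: p) = k * ev p by exact: mmapZ.
have killed u : two_sided_ideal (relators hb) u -> ev u = 0.
  elim=> [|v w _ v0 _ w0|a s b s_rel]; first exact: rmorph0.
    by rewrite rmorphD v0 w0 addr0.
  suff s0 : ev s = 0 by rewrite !rmorphM s0 mulr0 mul0r.
  by apply: suq_relators_kill s_rel; rewrite // /ev /= evalU.
by move=> /killed; rewrite rmorph1 => /eqP; rewrite oner_eq0.
Qed.

Definition qA (hb : C) := Quotient.quot (tsi_pred (relators hb)).

Section Quotient.
Variable hb : C.
Local Notation A := (qA hb).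
Local Notation I := (tsi_pred (relators hb)).

HB.instance Definition _ := GRing.Zmodule.on A.
HB.instance Definition _ := EqQuotient.on A.

Definition qpi (p : freeA) : A := locked_with qpi_key (\pi_A p).

Lemma qpiE p : qpi p = \pi_A p.
Proof. by rewrite /qpi unlock. Qed.

Lemma qpiP p q : qpi p = qpi q <-> two_sided_ideal (relators hb) (p - q).
Proof.
rewrite !qpiE; split=> [/eqP|pq].
  by rewrite -Quotient.idealrBE inE => /asboolP.
by apply/eqP; rewrite -Quotient.idealrBE inE; apply/asboolP.
Qed.

Lemma qpi_repr (a : A) : qpi (repr a) = a.
Proof. by rewrite qpiE reprK. Qed.

Lemma qpi_is_zmod : zmod_morphism qpi.
Proof. by move=> p q; rewrite !qpiE /= piE. Qed.

HB.instance Definition _ := GRing.isZmodMorphism.Build freeA A qpi qpi_is_zmod.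

Definition qmul (a b : A) : A := qpi (repr a * repr b).
Definition qscale (k : C) (a : A) : A := qpi (k *: repr a).

Lemma repr_qpi p : two_sided_ideal (relators hb) (repr (qpi p) - p).
Proof. by apply/qpiP; rewrite qpi_repr. Qed.

Lemma qpiM p q : qpi (p * q) = qmul (qpi p) (qpi q).
Proof.
apply/esym/qpiP; set p' := repr _; set q' := repr _.
have -> : p' * q' - p * q = (p' - p) * q' + p * (q' - q).
  by rewrite mulrBl mulrBr addrA subrK.
by apply: TSI_D; [apply: tsiMr|apply: tsiMl]; exact: repr_qpi.
Qed.

Lemma qpiZ k p : qpi (k *: p) = qscale k (qpi p).
Proof.
apply/esym/qpiP; rewrite -scalerBr -[_ - _]mul1r scalerAl.
by apply: tsiMl; exact: repr_qpi.
Qed.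

Lemma qmulA : associative qmul.
Proof. by move=> a b c; rewrite -[a]qpi_repr -[b]qpi_repr -[c]qpi_repr -!qpiM mulrA. Qed.
Lemma qmul1 : left_id (qpi 1) qmul.
Proof. by move=> a; rewrite -[a]qpi_repr -!qpiM mul1r. Qed.
Lemma qmulr1 : right_id (qpi 1) qmul.
Proof. by move=> a; rewrite -[a]qpi_repr -!qpiM mulr1. Qed.
Lemma qmulDl : left_distributive qmul +%R.
Proof.
move=> a b c; rewrite -[a]qpi_repr -[b]qpi_repr -[c]qpi_repr.
by rewrite -raddfD -!qpiM mulrDl raddfD.
Qed.
Lemma qmulDr : right_distributive qmul +%R.
Proof.
move=> a b c; rewrite -[a]qpi_repr -[b]qpi_repr -[c]qpi_repr.
by rewrite -raddfD -!qpiM mulrDr raddfD.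
Qed.
Lemma qone_neq0 : qpi 1 != 0.
Proof.
apply/eqP; rewrite -(raddf0 qpi) => /qpiP.
by rewrite subr0; exact: tsi_proper.
Qed.

HB.instance Definition _ := GRing.Zmodule_isNzRing.Build A
  qmulA qmul1 qmulr1 qmulDl qmulDr qone_neq0.

Lemma qscaleA a b v : qscale a (qscale b v) = qscale (a * b) v.
Proof. by rewrite -[v]qpi_repr -!qpiZ scalerA. Qed.
Lemma qscale1 : left_id 1 qscale.
Proof. by move=> v; rewrite -[v]qpi_repr -!qpiZ scale1r. Qed.
Lemma qscaleDr : right_distributive qscale +%R.
Proof.
by move=> a u v; rewrite -[u]qpi_repr -[v]qpi_repr -raddfD -!qpiZ scalerDr raddfD.
Qed.
Lemma qscaleDl v : {morph qscale^~ v : a b / a + b}.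
Proof. by move=> a b; rewrite -[v]qpi_repr -!qpiZ scalerDl raddfD. Qed.

HB.instance Definition _ := GRing.Zmodule_isLmodule.Build C A
  qscaleA qscale1 qscaleDr qscaleDl.

Lemma qscaleAl (k : C) (u v : A) : k *: (u * v) = k *: u * v.
Proof.
rewrite -[u]qpi_repr -[v]qpi_repr.
by rewrite -[LHS]/(qscale _ (qmul _ _)) -[RHS]/(qmul (qscale _ _) _)
  -qpiM -!qpiZ -qpiM scalerAl.
Qed.
HB.instance Definition _ := GRing.Lmodule_isLalgebra.Build C A qscaleAl.

Lemma qscaleAr (k : C) (u v : A) : k *: (u * v) = u * (k *: v).
Proof.
rewrite -[u]qpi_repr -[v]qpi_repr.
by rewrite -[LHS]/(qscale _ (qmul _ _)) -[RHS]/(qmul _ (qscale _ _))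
  -qpiM -!qpiZ -qpiM malg_scalerAr.
Qed.
HB.instance Definition _ := GRing.Lalgebra_isAlgebra.Build C A qscaleAr.

Lemma qpi_is_monoid : monoid_morphism qpi.
Proof. by split; [exact: erefl | exact: qpiM]. Qed.
HB.instance Definition _ :=
  GRing.isMonoidMorphism.Build freeA A qpi qpi_is_monoid.
HB.instance Definition _ := GRing.isScalable.Build C freeA A *:%R qpi qpiZ.

Definition qx : A := qpi fx.
Definition qy : A := qpi fy.
Definition qz : A := qpi fz.
Definition qt : A := qpi ft.
Definition qr : A := qpi fr.

Lemma qA_relations s : s \in suq_relators hb qx qy qz qt qr -> s = 0.
Proof.
rewrite /qx -map_suq_relators => /mapP[u u_rel ->].
by rewrite -(raddf0 qpi); apply/qpiP; rewrite subr0; exact: tsi_gen.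
Qed.
End Quotient.

(* An embedding of A into a division ring in which every element is a right
   fraction a s^-1. *)
Definition skew_field_of_fractions (A : algType C) (B : unitAlgType C)
    (iota : {lrmorphism A -> B}) : Prop :=
  [/\ forall u : B, u != 0 -> u \is a GRing.unit,
      injective iota
    & forall u : B, exists a s : A, s != 0 /\ u = iota a / iota s].

Section Derivatives.
Variables (hb : C) (B : unitAlgType C).

Definition mx2 (m00 m01 m10 m11 : B) : 'M[B]_2 :=
  \matrix_(i < 2, j < 2)
    if i == 0 then (if j == 0 then m00 else m01)
    else (if j == 0 then m10 else m11).

(* The homomorphism D, with values in the 2 x 2 matrices over B; A is viewed
   inside B through iota.  The field D_scal is C-linearity: the library has no
   C-algebra structure on matrices over a noncommutative C-algebra. *)
Record is_qD (iota : {lrmorphism qA hb -> B})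
    (D : {rmorphism qA hb -> 'M[B]_2}) : Prop := IsQD {
  D_scal : forall k : C, D k%:A = (k%:A)%:M;
  D_t : D (qt hb) = (iota (qt hb) + ('i * hb)%:A)%:M;
  D_x : D (qx hb) = mx2 (iota (qx hb)) (- hb%:A) (- hb%:A) (iota (qx hb));
  D_y : D (qy hb) = mx2 (iota (qy hb)) (- ('i * hb)%:A)
                        ('i * hb)%:A (iota (qy hb));
  D_z : D (qz hb) = mx2 (iota (qz hb) - hb%:A) 0 0 (iota (qz hb) + hb%:A);
  D_r : let x := iota (qx hb) in let y := iota (qy hb) in
        let z := iota (qz hb) in let r := iota (qr hb) in
        D (qr hb) = r^-1 *: mx2 (r ^+ 2 + (hb ^+ 2)%:A - hb *: z)
                                (- (hb *: (x + 'i *: y)))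
                                (- (hb *: (x - 'i *: y)))
                                (r ^+ 2 + (hb ^+ 2)%:A + hb *: z) }.

(* dt and grad = (dx, dy, dz) are the partial derivatives of a that are read
   off from the matrix M = D(a). *)
Definition is_qpartials (a : B) (M : 'M[B]_2) (dt : B) (grad : 'rV[B]_3) : Prop :=
  let dth := dt + (2 / hpar hb) *: a in
  let dx := grad 0 0 in let dy := grad 0 1 in let dz := grad 0 2 in
  M = ('i * hb)%:A *: mx2 (dth + 'i *: dz) ('i *: dx - dy)
                          ('i *: dx + dy) (dth - 'i *: dz).

Definition is_inverse_mx (M N : 'M[B]_2) : Prop :=
  M *m N = 1%:M /\ N *m M = 1%:M.

(* The indices are taken modulo 3. *)
Definition crossv (u v : 'rV[B]_3) : 'rV[B]_3 :=
  \row_k (u 0 (k + 1) * v 0 (k + 2) - u 0 (k + 2) * v 0 (k + 1)).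
End Derivatives.
End Presentation.

(* Main.v *)
Require Import Defs.
From HB Require Import structures.
From mathcomp Require Import all_boot all_order all_algebra.
From mathcomp Require Import complex reals.
From mathcomp Require Import finmap monalg ring.
Set Implicit Arguments.
Unset Strict Implicit.
Unset Printing Implicit Defensive.
Import Order.TTheory GRing.Theory Num.Theory.
Local Open Scope ring_scope.

(* Put u = b - D(b) and v = r - D(r).  Then u^2 = v^2 = hb^2 (u is hb times a
   Pauli matrix, as |alpha| = 1), r is central, D(b) commutes with b, and D(r)
   commutes with D(b) because D is multiplicative and r is central in A.  These
   rules alone give (D(r) - D(b)) N = c (c^2 - 4 hb^2) for the numerator N of
   the claimed inverse with coefficients on the right of D(r) and D(b), and the
   mirror identity with coefficients on the left; so the two one-sided inverses
   exist and agree.  The denominators are invertible because the character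
   x, y, z, t |-> 0, r |-> hb maps r - b + k to hb + k, which is nonzero for
   k = 0, 2 hb, - 2 hb.  Finally the partial derivatives are determined by
   the matrix, so it is enough to verify the four entries of the stated ones. *)

(** * Normal forms in a noncommutative algebra *)

Section NcNormalForm.
Variables (K : comPzRingType) (A : pzRingType) (sc : K -> A -> A).

(** Coefficients act through an abstract [sc], so that one normaliser serves both an algebra with
    [*:] and a bare ring with integer multiples [*~]. *)
Record is_scaling : Prop := IsScaling {
  ncs_Dl : forall k l a, sc (k + l) a = sc k a + sc l a;
  ncs_Dr : forall k a b, sc k (a + b) = sc k a + sc k b;
  ncs_Ml : forall k a b, sc k (a * b) = sc k a * b;
  ncs_Mr : forall k a b, sc k (a * b) = a * sc k b;
  ncs_M : forall k l a, sc (k * l) a = sc k (sc l a);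
  ncs_1 : forall a, sc 1 a = a }.

Inductive ncexpr :=
| NcAtom of nat | Nc0 | Nc1
| NcAdd of ncexpr & ncexpr | NcOpp of ncexpr | NcMul of ncexpr & ncexpr
| NcExp of ncexpr & nat | NcMuln of ncexpr & nat | NcScale of K & ncexpr.

Variable env : seq A.

Fixpoint nceval (e : ncexpr) : A :=
  match e with
  | NcAtom i => nth 0 env i
  | Nc0 => 0
  | Nc1 => 1
  | NcAdd e f => nceval e + nceval f
  | NcOpp e => - nceval e
  | NcMul e f => nceval e * nceval f
  | NcExp e n => nceval e ^+ n
  | NcMuln e n => nceval e *+ n
  | NcScale k e => sc k (nceval e)
  end.

Definition ncpoly := seq (seq nat * K).

Definition ncw_eval (w : seq nat) : A := foldr (fun i a => nth 0 env i * a) 1 w.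

Definition ncp_eval (p : ncpoly) : A := foldr (fun m a => sc m.2 (ncw_eval m.1) + a) 0 p.

Definition ncp_scale (k : K) (p : ncpoly) : ncpoly := map (fun m => (m.1, k * m.2)) p.

Definition ncp_mul (p q : ncpoly) : ncpoly :=
  foldr (fun m s => map (fun n => (m.1 ++ n.1, m.2 * n.2)) q ++ s) [::] p.

(** A recursion through [eqn], so that words are compared by the selective [cbv] of [nc_norm] while
    the coefficients stay symbolic. *)
Fixpoint ncw_eqb (v w : seq nat) : bool :=
  match v, w with
  | [::], [::] => true
  | i :: v, j :: w => if eqn i j then ncw_eqb v w else false
  | _, _ => false
  end.

Fixpoint ncp_insert (m : seq nat * K) (p : ncpoly) : ncpoly :=
  match p with
  | [::] => [:: m]
  | n :: p => if ncw_eqb m.1 n.1 then (n.1, m.2 + n.2) :: p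
              else n :: ncp_insert m p
  end.

Definition ncp_collect (p : ncpoly) : ncpoly := foldr ncp_insert [::] p.

Fixpoint ncp_exp (p : ncpoly) (n : nat) : ncpoly :=
  if n is n.+1 then ncp_collect (ncp_mul p (ncp_exp p n)) else [:: ([::], 1)].

Fixpoint nc_nf (e : ncexpr) : ncpoly :=
  match e with
  | NcAtom i => [:: ([:: i], 1)]
  | Nc0 => [::]
  | Nc1 => [:: ([::], 1)]
  | NcAdd e f => ncp_collect (nc_nf e ++ nc_nf f)
  | NcOpp e => ncp_scale (- 1) (nc_nf e)
  | NcMul e f => ncp_collect (ncp_mul (nc_nf e) (nc_nf f))
  | NcExp e n => ncp_exp (nc_nf e) n
  | NcMuln e n => ncp_scale n%:R (nc_nf e)
  | NcScale k e => ncp_scale k (nc_nf e)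
  end.

(* The rule ((i, j), p) rewrites two adjacent letters i, j of a word to p. *)
Definition ncrule := (nat * nat * ncpoly)%type.

Definition ncrule_ok (u : ncrule) : Prop :=
  nth 0 env u.1.1 * nth 0 env u.1.2 = ncp_eval u.2.

Fixpoint ncrules_ok (s : seq ncrule) : Prop :=
  if s is u :: s then ncrule_ok u /\ ncrules_ok s else True.

Fixpoint ncrule_find (s : seq ncrule) (i j : nat) : option ncpoly :=
  match s with
  | [::] => None
  | u :: s => if eqn i u.1.1 then if eqn j u.1.2 then Some u.2 else ncrule_find s i j
              else ncrule_find s i j
  end.

Fixpoint ncw_step (s : seq ncrule) (w : seq nat) : option ncpoly :=
  match w with
  | [::] => None
  | i :: v =>
    let rest := match ncw_step s v with
                | None => None
                | Some p => Some (map (fun m => (i :: m.1, m.2)) p)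
                end in
    match v with
    | [::] => None
    | j :: v => match ncrule_find s i j with
                | None => rest
                | Some p => Some (map (fun m => (m.1 ++ v, m.2)) p)
                end
    end
  end.

Fixpoint ncp_step (s : seq ncrule) (p : ncpoly) : ncpoly :=
  match p with
  | [::] => [::]
  | m :: p => match ncw_step s m.1 with
              | None => m :: ncp_step s p
              | Some q => ncp_scale m.2 q ++ ncp_step s p
              end
  end.

Fixpoint ncp_reducible (s : seq ncrule) (p : ncpoly) : bool :=
  match p with
  | [::] => false
  | m :: p => if ncw_step s m.1 is Some _ then true else ncp_reducible s p
  end.

(** [n] bounds the number of passes; a pass rewrites the leftmost redex of every reducible
    monomial. *)
Fixpoint ncp_reduce (n : nat) (s : seq ncrule) (p : ncpoly) : ncpoly :=
  if n is n.+1 then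
    if ncp_reducible s p then ncp_reduce n s (ncp_collect (ncp_step s p)) else p
  else p.

(** Collection never tests a coefficient for zero; the vanishing is left as equations in [K],
    settled by computation, [ring] or [field]. *)
Fixpoint ncp_is0 (p : ncpoly) : Prop :=
  if p is m :: p then m.2 = 0 /\ ncp_is0 p else True.

Hypothesis scP : is_scaling.

Let sc0l a : sc 0 a = 0.
Proof. by apply: (addIr (sc 0 a)); rewrite add0r -(ncs_Dl scP) addr0. Qed.

Let sc0r k : sc k 0 = 0.
Proof. by apply: (addIr (sc k 0)); rewrite add0r -(ncs_Dr scP) addr0. Qed.

Let scN1 a : sc (- 1) a = - a.
Proof.
by apply: (addIr a); rewrite addNr -{2}[a](ncs_1 scP) -(ncs_Dl scP) addNr sc0l.
Qed.

Let sc_nat n a : sc n%:R a = a *+ n.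
Proof.
elim: n => [|n IHn]; first by rewrite sc0l.
by rewrite mulrSr (ncs_Dl scP) IHn (ncs_1 scP) mulrSr.
Qed.

Let scMM k l a b : sc (k * l) (a * b) = sc k a * sc l b.
Proof. by rewrite (ncs_M scP) (ncs_Mr scP l) (ncs_Ml scP). Qed.

Lemma ncw_eval_cat v w : ncw_eval (v ++ w) = ncw_eval v * ncw_eval w.
Proof. by elim: v => [|i v IHv] /=; rewrite ?mul1r // IHv mulrA. Qed.

Lemma ncp_eval_cat p q : ncp_eval (p ++ q) = ncp_eval p + ncp_eval q.
Proof. by elim: p => [|m p IHp] /=; rewrite ?add0r // IHp addrA. Qed.

Lemma ncp_eval_scale k p : ncp_eval (ncp_scale k p) = sc k (ncp_eval p).
Proof.
by elim: p => [|m p IHp] /=; rewrite ?sc0r // IHp (ncs_Dr scP) (ncs_M scP).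
Qed.

Lemma ncp_eval_mul p q : ncp_eval (ncp_mul p q) = ncp_eval p * ncp_eval q.
Proof.
elim: p => [|m p IHp] /=; first by rewrite mul0r.
rewrite ncp_eval_cat IHp mulrDl; congr (_ + _).
elim: q {IHp} => [|n q IHq] /=; first by rewrite mulr0.
by rewrite IHq mulrDr ncw_eval_cat scMM.
Qed.

Lemma ncw_eqbP v w : ncw_eqb v w -> v = w.
Proof.
elim: v w => [|i v IHv] [|j w] //=.
by case: (@eqnP i j) => // -> /IHv ->.
Qed.

Lemma ncp_eval_insert m p : ncp_eval (ncp_insert m p) = sc m.2 (ncw_eval m.1) + ncp_eval p.
Proof.
elim: p => [|n p IHp] //=; case: ifP => [/ncw_eqbP -> /=|_ /=].
  by rewrite (ncs_Dl scP) addrA.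
by rewrite IHp addrCA.
Qed.

Lemma ncp_eval_collect p : ncp_eval (ncp_collect p) = ncp_eval p.
Proof. by elim: p => [|m p IHp] //=; rewrite ncp_eval_insert IHp. Qed.

Lemma nc_nfP e : ncp_eval (nc_nf e) = nceval e.
Proof.
elim: e => //=.
- by move=> i; rewrite (ncs_1 scP) mulr1 addr0.
- by rewrite (ncs_1 scP) addr0.
- by move=> e IHe f IHf; rewrite ncp_eval_collect ncp_eval_cat IHe IHf.
- by move=> e IHe; rewrite ncp_eval_scale IHe scN1.
- by move=> e IHe f IHf; rewrite ncp_eval_collect ncp_eval_mul IHe IHf.
- move=> e IHe; elim=> [|n IHn] /=; first by rewrite (ncs_1 scP) addr0.
  by rewrite ncp_eval_collect ncp_eval_mul IHe IHn exprS.
- by move=> e IHe n; rewrite ncp_eval_scale IHe sc_nat.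
- by move=> k e IHe; rewrite ncp_eval_scale IHe.
Qed.

Lemma ncp_eval_catr p v :
  ncp_eval (map (fun m => (m.1 ++ v, m.2)) p) = ncp_eval p * ncw_eval v.
Proof.
elim: p => [|m p IHp] /=; first by rewrite mul0r.
by rewrite IHp mulrDl ncw_eval_cat (ncs_Ml scP).
Qed.

Lemma ncp_eval_consl p i :
  ncp_eval (map (fun m => (i :: m.1, m.2)) p) = nth 0 env i * ncp_eval p.
Proof.
elim: p => [|m p IHp] /=; first by rewrite mulr0.
by rewrite IHp mulrDr (ncs_Mr scP).
Qed.

Section Rules.
Variable s : seq ncrule.
Hypothesis s_ok : ncrules_ok s.

Lemma ncrule_findP i j p :
  ncrule_find s i j = Some p -> nth 0 env i * nth 0 env j = ncp_eval p.
Proof.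
elim: (s) s_ok => [|u s' IHs] //= [u_ok s'_ok].
case: (@eqnP i u.1.1) => [def_i|_]; last exact: IHs.
case: (@eqnP j u.1.2) => [def_j [<-]|_]; last exact: IHs.
by rewrite def_i def_j.
Qed.

Lemma ncw_stepP w p : ncw_step s w = Some p -> ncw_eval w = ncp_eval p.
Proof.
elim: w p => [|i [|j v] IHv] //= p.
case def_q: (ncrule_find s i j) => [q|].
  by case=> <-; rewrite ncp_eval_catr mulrA (ncrule_findP def_q).
move: IHv; rewrite -/(ncw_step s (j :: v)); case: (ncw_step _ _) => // q IHv [<-].
by rewrite ncp_eval_consl -(IHv q).
Qed.

Lemma ncp_eval_step p : ncp_eval (ncp_step s p) = ncp_eval p.
Proof.
elim: p => //= m p IHp; case def_q: (ncw_step s m.1) => [q|] /=; last by rewrite IHp.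
by rewrite ncp_eval_cat IHp ncp_eval_scale (ncw_stepP def_q).
Qed.

Lemma ncp_eval_reduce n p : ncp_eval (ncp_reduce n s p) = ncp_eval p.
Proof.
elim: n p => //= n IHn p; case: ifP => // _.
by rewrite IHn ncp_eval_collect ncp_eval_step.
Qed.

(** Every pass preserves the value, so any [n] and any valid rules are sound; termination and
    confluence bear only on whether the remaining coefficients vanish. *)
Lemma nceval_eq n e f :
  ncp_is0 (ncp_reduce n s (nc_nf (NcAdd e (NcOpp f)))) -> nceval e = nceval f.
Proof.
move=> is0; apply/eqP; rewrite -subr_eq0; apply/eqP.
rewrite -[LHS]/(nceval (NcAdd e (NcOpp f))) -nc_nfP -(ncp_eval_reduce n).
elim: (ncp_reduce _ _ _) is0 => //= m p IHp [-> /IHp->].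
by rewrite sc0l addr0.
Qed.
End Rules.
End NcNormalForm.

(** * Scalar actions and the reflexive tactics *)

Lemma is_scaling_alg (K : comNzRingType) (A : algType K) :
  is_scaling (fun (k : K) (a : A) => k *: a).
Proof.
split=> *; rewrite ?scalerDl ?scalerDr ?scalerAl ?scalerA ?scale1r //.
by rewrite -scalerAl scalerAr.
Qed.

Lemma is_scaling_int (A : pzRingType) : is_scaling (fun (k : int) (a : A) => a *~ k).
Proof.
split=> *; rewrite ?mulrzDr ?mulrzDl ?mulrzAl ?mulrzAr ?mulr1z //.
by rewrite mulrC -mulrzA.
Qed.

Ltac nc_mem x l :=
  lazymatch l with
  | nil => constr:(false)
  | cons x _ => constr:(true)
  | cons _ ?l' => nc_mem x l'
  end.

Ltac nc_index x l :=
  lazymatch l with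
  | cons x _ => constr:(O)
  | cons _ ?l' => let n := nc_index x l' in constr:(S n)
  end.

Ltac nc_atoms t l :=
  lazymatch t with
  | 0 => l
  | 1 => l
  | ?a + ?b => let l := nc_atoms a l in nc_atoms b l
  | - ?a => nc_atoms a l
  | ?a * ?b => let l := nc_atoms a l in nc_atoms b l
  | ?a ^+ _ => nc_atoms a l
  | ?a *+ _ => nc_atoms a l
  | _ *: ?a => nc_atoms a l
  | _ => let m := nc_mem t l in
    lazymatch m with true => l | false => constr:(cons t l) end
  end.

Ltac nc_reify K t l :=
  lazymatch t with
  | 0 => constr:(@Nc0 K)
  | 1 => constr:(@Nc1 K)
  | ?a + ?b =>
    let e := nc_reify K a l in let f := nc_reify K b l in constr:(@NcAdd K e f)
  | - ?a => let e := nc_reify K a l in constr:(@NcOpp K e)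
  | ?a * ?b =>
    let e := nc_reify K a l in let f := nc_reify K b l in constr:(@NcMul K e f)
  | ?a ^+ ?n => let e := nc_reify K a l in constr:(@NcExp K e n)
  | ?a *+ ?n => let e := nc_reify K a l in constr:(@NcMuln K e n)
  | ?k *: ?a => let e := nc_reify K a l in constr:(@NcScale K k e)
  | _ => let n := nc_index t l in constr:(@NcAtom K n)
  end.

Ltac nc_rule_atoms H l :=
  lazymatch H with
  | tt => l
  | (?H', ?h) =>
    let l := nc_rule_atoms H' l in
    lazymatch type of h with ?a = ?b => let l := nc_atoms a l in nc_atoms b l end
  end.

Ltac nc_rules K H l :=
  lazymatch H with
  | tt => constr:(@nil (ncrule K))
  | (?H', ?h) =>
    let s := nc_rules K H' l in
    lazymatch type of h with
    | ?a * ?b = ?c =>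
      let i := nc_index a l in let j := nc_index b l in let e := nc_reify K c l in
      constr:(cons (i, j, nc_nf e) s)
    end
  end.

Ltac nc_rules_ok scP H :=
  lazymatch H with
  | tt => exact I
  | (?H', ?h) =>
    split; [refine (eq_trans h _); symmetry; exact (nc_nfP _ scP _)|nc_rules_ok scP H']
  end.

(* The cast to the virtual machine is essential: the default conversion of the
   kernel does not terminate in reasonable time on this computation. *)
Ltac nc_norm :=
  match goal with |- ?G =>
    let G' := eval cbv [ncp_is0 ncp_reduce ncp_reducible ncp_step ncw_step ncrule_find nc_nf ncp_exp
       ncp_collect ncp_insert ncw_eqb ncp_mul ncp_scale foldr map cat eqn fst snd] in G in
    let H := fresh in
    enough (H : G') by (vm_cast_no_check H)
  end.

(* Reduces an equation in a ring to the vanishing of the coefficients of its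
   normal form with respect to the rewriting rules H = (tt, h1, ..., hn), where
   hi : a * b = e for atoms a, b. *)
Ltac nc_eq_with K scP H :=
  lazymatch goal with
  | |- @eq ?T ?a ?b =>
    let l := nc_rule_atoms H (@nil T) in
    let l := nc_atoms a l in let l := nc_atoms b l in
    let s := nc_rules K H l in
    let e := nc_reify K a l in let f := nc_reify K b l in
    refine (@nceval_eq _ _ _ l scP s _ 40 e f _);
    [nc_rules_ok scP H|nc_norm; repeat split]
  end.

Tactic Notation "nc_alg" constr(K) constr(A) constr(H) :=
  nc_eq_with K (@is_scaling_alg K A) H.
Tactic Notation "nc_int" constr(A) constr(H) := nc_eq_with int (is_scaling_int A) H.

(** * The inverse of D(r) - D(b) *)

Section InverseOfDifference.
Variables (B : unitRingType) (S : pzRingType) (f : {rmorphism B -> S}).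
Variables (r b k : B) (P Q : S).
Hypothesis rb : r * b = b * r.
Hypothesis rk : r * k = k * r.
Hypothesis bk : b * k = k * b.
Hypothesis Pr : P * f r = f r * P.
Hypothesis Pk : P * f k = f k * P.
Hypothesis Qr : Q * f r = f r * Q.
Hypothesis Qb : Q * f b = f b * Q.
Hypothesis Qk : Q * f k = f k * Q.
Hypothesis PQ : P * Q = Q * P.
Hypothesis P2 : (f r - P) ^+ 2 = f k.
Hypothesis Q2 : (f b - Q) ^+ 2 = f k.

Let den := (r - b) * ((r - b) ^+ 2 - 4 * k).
Let n0 := 2 * (r ^+ 2 + b ^+ 2 - 3 * (b * r) - k).
Let n1 := 3 * b - r.
Let n2 := 3 * r - b.

Let P2E : P * P = f r * P *+ 2 - f r ^+ 2 + f k.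
Proof. by rewrite -P2; nc_int S (tt, Pr). Qed.

Let frb : f b * f r = f r * f b. Proof. by rewrite -!rmorphM rb. Qed.
Let frk : f r * f k = f k * f r. Proof. by rewrite -!rmorphM rk. Qed.
Let fbk : f b * f k = f k * f b. Proof. by rewrite -!rmorphM bk. Qed.

(* With the coefficients on the right of P and Q, no commutation of P with b is
   needed; likewise on the left in the next lemma. *)
Let mul_right : (P - Q) * (f n0 + P * f n1 + Q * f n2 + P * Q * f (- 2)) = f den.
Proof.
have Q2E : Q * Q = Q * f b *+ 2 - f b ^+ 2 + f k by rewrite -Q2; nc_int S (tt, Qb).
rewrite /den /n0 /n1 /n2 !(rmorphM, rmorphB, rmorphD, rmorphN, rmorph1).
move: (f r) (f b) (f k) Pr Pk Qr Qb Qk frb frk fbk P2E Q2E => r' b' k' H1 H2 H3 H4 H5 H6 H7 H8 H9 H10.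
(* [esym PQ] moves [Q] to the right of [P], so the [f b] coming from [Q * Q] also stays to the right
   of [P]. *)
by nc_int S (tt, H1, H2, H3, H4, H5, H6, H7, H8, H9, H10, esym PQ).
Qed.

Let mul_left : (f n0 + f n1 * P + f n2 * Q + f (- 2) * (P * Q)) * (P - Q) = f den.
Proof.
have Q2E : Q * Q = f b * Q *+ 2 - f b ^+ 2 + f k by rewrite -Q2; nc_int S (tt, Qb).
rewrite /den /n0 /n1 /n2 !(rmorphM, rmorphB, rmorphD, rmorphN, rmorph1).
move: (f r) (f b) (f k) Pr Pk Qr Qb Qk frb frk fbk P2E Q2E => r' b' k' H1 H2 H3 H4 H5 H6 H7 H8 H9 H10.
(* The opposite orientation: [Q] and the [f b] it produces stay to the left of [P]. *)
by nc_int S (tt, H1, H2, H3, H4, H5, H6, H7, H8, H9, H10, PQ).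
Qed.

Lemma inverse_of_difference (N := f (n0 / den) + P * f (n1 / den) + Q * f (n2 / den)
                                  + P * Q * f (- 2 / den)) :
  den \is a GRing.unit -> (P - Q) * N = 1 /\ N * (P - Q) = 1.
Proof.
rewrite {}/N; move: mul_right mul_left; move: n0 n1 n2 (- 2) den => m0 m1 m2 m3 d.
set N' := f m0 + _ + _ + _; set L := _ + _ + _ + f m3 * _ => N'_right L_left d_unit.
have -> : f (m0 / d) + P * f (m1 / d) + Q * f (m2 / d) + P * Q * f (m3 / d) = N' * f d^-1.
  by rewrite !rmorphM /N' !mulrDl !mulrA.
have right : (P - Q) * (N' * f d^-1) = 1.
  by rewrite mulrA N'_right -rmorphM divrr // rmorph1.
split=> //; suff -> : N' * f d^-1 = f d^-1 * L.
  by rewrite -mulrA L_left -rmorphM mulVr // rmorph1.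
(* The left inverse [f d^-1 * L], multiplied by [right], becomes the right inverse. *)
rewrite -[RHS]mulr1 -right mulrA -(mulrA (f _)) L_left -rmorphM mulVr //.
by rewrite rmorph1 mul1r.
Qed.
End InverseOfDifference.

(** * Nonvanishing of affine elements of the quotient algebra *)

Section QuotientNonzero.
Variables (C : numClosedFieldType) (hb : C).

Lemma map_lincomb (F G : lalgType C) (f : {lrmorphism F -> G}) a1 a2 a3 x y z :
  f (a1 *: x + a2 *: y + a3 *: z) = a1 *: f x + a2 *: f y + a3 *: f z.
Proof. by rewrite !linearD !linearZ. Qed.

Lemma map_affine (F G : lalgType C) (f : {lrmorphism F -> G}) k a1 a2 a3 x y z r :
  f (r + k%:A - (a1 *: x + a2 *: y + a3 *: z))
  = f r + k%:A - (a1 *: f x + a2 *: f y + a3 *: f z).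
Proof. by rewrite linearB linearD linearZ /= rmorph1 map_lincomb. Qed.

Lemma ev_affine (F : lalgType C) (ev : {rmorphism F -> C}) k a1 a2 a3 x y z r :
    (forall c p, ev (c *: p) = c * ev p) ->
    ev x = 0 -> ev y = 0 -> ev z = 0 -> ev r = hb ->
  ev (r + k%:A - (a1 *: x + a2 *: y + a3 *: z)) = hb + k.
Proof.
move=> evZ evx evy evz evr; rewrite rmorphB !rmorphD !evZ rmorph1 evx evy evz evr.
by rewrite mulr1 !mulr0 !addr0 subr0.
Qed.

Lemma qr_sub_neq0 (k a1 a2 a3 : C) : hb + k != 0 ->
  qr hb + k%:A - (a1 *: qx hb + a2 *: qy hb + a3 *: qz hb) != 0.
Proof.
(* The point (0, 0, 0, 0, hb) lies on the quadric x^2 + y^2 + z^2 + hb^2 = r^2, and commutators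
   vanish in [C], so evaluation there kills the ideal. *)
pose e (i : 'I_5) : C := if val i == 4%N then hb else 0.
pose ev : {rmorphism freeA C -> C} := mmap idfun (evalw e).
have evZ c p : ev (c *: p) = c * ev p by exact: mmapZ.
have killed u : two_sided_ideal (relators hb) u -> ev u = 0.
  elim=> [|v w _ v0 _ w0|a s b s_rel]; first exact: rmorph0.
    by rewrite rmorphD v0 w0 addr0.
  suff s0 : ev s = 0 by rewrite !rmorphM s0 mulr0 mul0r.
  by apply: suq_relators_kill s_rel; rewrite // /ev /= evalU.
pose p : freeA C := fr C + k%:A - (a1 *: fx C + a2 *: fy C + a3 *: fz C).
have <- : ev p = hb + k by apply: ev_affine => //; exact: evalU.
apply: contraNneq => p0; rewrite killed //.
have /qpiP : qpi hb p = qpi hb 0 by rewrite raddf0 -[RHS]p0 map_affine.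
by rewrite subr0.
Qed.
End QuotientNonzero.

(** * Entries and partial derivatives *)

Section TwoByTwo.
Variables (C : numClosedFieldType) (B : unitAlgType C).
Implicit Types a b c d : B.

Lemma mx2D a b c d a' b' c' d' :
  mx2 a b c d + mx2 a' b' c' d' = mx2 (a + a') (b + b') (c + c') (d + d').
Proof. by apply/matrixP => i j; rewrite !mxE; do !case: ifP. Qed.

Lemma mx2N a b c d : - mx2 a b c d = mx2 (- a) (- b) (- c) (- d).
Proof. by apply/matrixP => i j; rewrite !mxE; do !case: ifP. Qed.

Lemma mx2Z k a b c d : k *: mx2 a b c d = mx2 (k * a) (k * b) (k * c) (k * d).
Proof. by apply/matrixP => i j; rewrite !mxE; do !case: ifP. Qed.

Lemma mx2_scalar k : k%:M = mx2 k 0 0 k :> 'M[B]_2.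
Proof.
by apply/matrixP => i j; rewrite !mxE; case: i j => [[|[|//]] ?] [[|[|//]] ?].
Qed.

Lemma mx2M a b c d a' b' c' d' :
  mx2 a b c d *m mx2 a' b' c' d'
  = mx2 (a * a' + b * c') (a * b' + b * d') (c * a' + d * c') (c * b' + d * d').
Proof.
by apply/matrixP => i j; rewrite !mxE !big_ord_recl big_ord0 !mxE addr0;
  case: i j => [[|[|//]] ?] [[|[|//]] ?].
Qed.

Lemma mx2_inj a b c d a' b' c' d' : mx2 a b c d = mx2 a' b' c' d' ->
  [/\ a = a', b = b', c = c' & d = d'].
Proof.
by move=> /matrixP eqM; split;
  [have := eqM 0 0|have := eqM 0 1|have := eqM 1 0|have := eqM 1 1]; rewrite !mxE.
Qed.

Lemma mx2_eta (M : 'M[B]_2) : M = mx2 (M 0 0) (M 0 1) (M 1 0) (M 1 1).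
Proof.
by apply/matrixP => i j; rewrite !mxE; case: i j => [[|[|//]] ?] [[|[|//]] ?];
  congr (M _ _); apply: val_inj.
Qed.

Definition mx2E := (mx2_scalar, mx2D, mx2N, mx2Z, mx2M).

Lemma row3P (u v : 'rV[B]_3) :
  u 0 0 = v 0 0 -> u 0 1 = v 0 1 -> u 0 2 = v 0 2 -> u = v.
Proof.
move=> uv0 uv1 uv2; apply/rowP => -[[|[|[|//]]] lt_i].
- by rewrite (_ : Ordinal lt_i = 0) //; apply: val_inj.
- by rewrite (_ : Ordinal lt_i = 1) //; apply: val_inj.
- by rewrite (_ : Ordinal lt_i = 2) //; apply: val_inj.
Qed.
Lemma row_mul_scalar n (u : 'rV[B]_n) (k : B) j : (u *m k%:M) 0 j = u 0 j * k.
Proof.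
rewrite mxE (bigD1 j) //= mxE eqxx mulr1n big1 ?addr0 // => i ij.
by rewrite mxE (negPf ij) mulr0n mulr0.
Qed.

Lemma crossvE (u v : 'rV[B]_3) :
  [/\ crossv u v 0 0 = u 0 1 * v 0 2 - u 0 2 * v 0 1,
      crossv u v 0 1 = u 0 2 * v 0 0 - u 0 0 * v 0 2
    & crossv u v 0 2 = u 0 0 * v 0 1 - u 0 1 * v 0 0].
Proof.
by split; rewrite mxE; congr (u 0 _ * v 0 _ - u 0 _ * v 0 _); apply: val_inj.
Qed.

(** The four entries form a linear system in the four derivatives; sums and differences across the
    two diagonals solve it, as [hb] is invertible. *)
Lemma qpartials_eq (hb : C) (a : B) (M : 'M[B]_2) dt grad : hb != 0 ->
  is_qpartials hb a M dt grad ->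
  [/\ dt = (2 * 'i * hb)^-1 *: (M 0 0 + M 1 1) - (2 / hpar hb) *: a,
      grad 0 0 = - (2 * hb)^-1 *: (M 0 1 + M 1 0),
      grad 0 1 = (2 * 'i * hb)^-1 *: (M 1 0 - M 0 1)
    & grad 0 2 = - (2 * hb)^-1 *: (M 0 0 - M 1 1)].
Proof.
move=> hb0 ->; rewrite mx2Z !mxE /=.
move: (grad 0 0) (grad 0 1) (grad 0 2) => dx dy dz.
have ii : 'i ^+ 2 = -1 :> C := sqrCi C; have i0 := neq0Ci C.
split; nc_alg C B tt; rewrite /hpar.
all: by field: ii; rewrite ?hb0 ?i0.
Qed.

(** Reduces the equivalence in the theorem to checking that the stated derivatives are one
    solution. *)
Lemma qpartials_uniq (hb : C) (a : B) (M : 'M[B]_2) dt grad dt' grad' : hb != 0 ->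
    is_qpartials hb a M dt' grad' ->
  is_qpartials hb a M dt grad <-> dt = dt' /\ grad = grad'.
Proof.
move=> hb0 M'; split=> [M1|[-> ->] //].
have [-> g0 g1 g2] := qpartials_eq hb0 M1; have [-> g0' g1' g2'] := qpartials_eq hb0 M'.
by split=> //; apply: row3P; rewrite ?(g0, g1, g2) ?(g0', g1', g2').
Qed.
End TwoByTwo.

Lemma comm_lincomb (K : comNzRingType) (A : algType K) (r x y z : A) (a1 a2 a3 : K) :
    r * x = x * r -> r * y = y * r -> r * z = z * r ->
  r * (a1 *: x + a2 *: y + a3 *: z) = (a1 *: x + a2 *: y + a3 *: z) * r.
Proof.
by move=> rx ry rz; rewrite !mulrDr !mulrDl -!scalerAl -!scalerAr rx ry rz.
Qed.

(** * Computations with the explicit matrices of D(r) and D(b) *)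

Section Derivations.
Variables (C : numClosedFieldType) (hb : C) (B : unitAlgType C).
Variables (x y z r : B) (a1 a2 a3 : C).
Hypothesis hb_neq0 : hb != 0.
Hypothesis xy : comm_br x y = hpar hb *: z.
Hypothesis yz : comm_br y z = hpar hb *: x.
Hypothesis zx : comm_br z x = hpar hb *: y.
Hypothesis rx : r * x = x * r.
Hypothesis ry : r * y = y * r.
Hypothesis rz : r * z = z * r.
Hypothesis cas : x ^+ 2 + y ^+ 2 + z ^+ 2 + (hb ^+ 2)%:A = r ^+ 2.
Hypothesis r_unit : r \is a GRing.unit.
Hypothesis aa : a1 ^+ 2 + a2 ^+ 2 + a3 ^+ 2 = 1.

Let b := a1 *: x + a2 *: y + a3 *: z.
Let c := r - b.
Let E := c ^+ 2 - (4 * hb ^+ 2)%:A.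

Definition qD_r : 'M[B]_2 :=
  r^-1 *: mx2 (r ^+ 2 + (hb ^+ 2)%:A - hb *: z) (- (hb *: (x + 'i *: y)))
              (- (hb *: (x - 'i *: y))) (r ^+ 2 + (hb ^+ 2)%:A + hb *: z).

(** In Pauli matrices s1, s2, s3 this is b - hb (a1 s1 - a2 s2 + a3 s3); the combination in brackets
    squares to a1^2 + a2^2 + a3^2 = 1. *)
Definition qD_b : 'M[B]_2 :=
  mx2 (b - (hb * a3)%:A) (- (hb * (a1 + 'i * a2))%:A)
      (- (hb * (a1 - 'i * a2))%:A) (b + (hb * a3)%:A).

Let ii : 'i ^+ 2 = -1 :> C := sqrCi C.

Let a3sq : a3 ^+ 2 = 1 - a1 ^+ 2 - a2 ^+ 2.
Proof. by rewrite -aa; ring. Qed.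

Let Vr : r^-1 * r = 1. Proof. exact: mulVr. Qed.
Let rV : r * r^-1 = 1. Proof. exact: mulrV. Qed.

Let comm_Vr u : r * u = u * r -> u * r^-1 = r^-1 * u.
Proof.
move=> ru; apply: (mulrI r_unit); rewrite !mulrA ru rV mul1r.
by rewrite -mulrA rV mulr1.
Qed.

Let Vx := comm_Vr rx.
Let Vy := comm_Vr ry.
Let Vz := comm_Vr rz.

Lemma r_comm_b : r * b = b * r.
Proof. exact: comm_lincomb. Qed.

Lemma qD_r_commr : qD_r *m r%:M = r%:M *m qD_r.
Proof.
rewrite /qD_r !mx2E; congr mx2;
  move: r^-1 Vr rV Vx Vy Vz => s h1 h2 h3 h4 h5;
  nc_alg C B (tt, esym rx, esym ry, esym rz, h1, h2, h3, h4, h5); ring.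
Qed.

Lemma qD_b_commr : qD_b *m r%:M = r%:M *m qD_b.
Proof.
by rewrite /qD_b /b !mx2E; congr mx2; nc_alg C B (tt, rx, ry, rz); ring.
Qed.

Lemma qD_b_commb : qD_b *m b%:M = b%:M *m qD_b.
Proof. by rewrite /qD_b !mx2E; move: b => b'; congr mx2; nc_alg C B tt; ring. Qed.

Lemma mx2_comm_alg (M : 'M[B]_2) (k : C) : M *m k%:A%:M = k%:A%:M *m M.
Proof.
by rewrite [M]mx2_eta !mx2E; congr mx2; rewrite ?(mulr0, mul0r, addr0, add0r)
  mulr_algl mulr_algr.
Qed.

(** Put S = x s1 - y s2 + z s3 with Pauli matrices. Then r - D(r) = r^-1 hb (S - hb). The
    commutators and the quadric relation give S^2 = r^2 - hb^2 + 2 hb S, that is, (S - hb)^2 =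
    r^2. *)
Lemma qD_r_sqr : (r%:M - qD_r) *m (r%:M - qD_r) = (hb ^+ 2)%:A%:M.
Proof.
rewrite /qD_r !mx2E.
(* Rules for a Poincare-Birkhoff-Witt normal form: letters are ordered x, y, z, and [z * z] is
   eliminated by the quadric relation. *)
have yx : y * x = x * y - hpar hb *: z by rewrite -xy /comm_br opprB addrC subrK.
have zy : z * y = y * z - hpar hb *: x by rewrite -yz /comm_br opprB addrC subrK.
have zx' : z * x = x * z + hpar hb *: y by rewrite -zx /comm_br addrC subrK.
have zz : z * z = r * r - x * x - y * y - (hb ^+ 2)%:A.
  have := cas; rewrite !expr2 => <-; nc_alg C B tt; ring.
congr mx2; move: r^-1 Vr rV Vx Vy Vz => s h1 h2 h3 h4 h5;
  nc_alg C B (tt, esym rx, esym ry, esym rz, h1, h2, h3, h4, h5, yx, zy, zx', zz);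
  rewrite /hpar; ring: ii.
Qed.

Lemma qD_b_sqr : (b%:M - qD_b) *m (b%:M - qD_b) = (hb ^+ 2)%:A%:M.
Proof.
rewrite /qD_b !mx2E; move: b => b'.
by congr mx2; nc_alg C B tt; ring: ii a3sq.
Qed.

Hypothesis c_unit : c \is a GRing.unit.
Hypothesis E_unit : E \is a GRing.unit.

Let den := c * E.
Let n0 := 2 * (r ^+ 2 + b ^+ 2 - 3 * (b * r) - (hb ^+ 2)%:A).
Let n1 := 3 * b - r.
Let n2 := 3 * r - b.

Definition qD_inv : 'M[B]_2 :=
  (n0 / den)%:M + qD_r *m (n1 / den)%:M + qD_b *m (n2 / den)%:M
  + qD_r *m qD_b *m (- 2 / den)%:M.

Let rvec : 'rV[B]_3 := \row_k [:: x; y; z]`_k.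
Let avec : 'rV[B]_3 := \row_k [:: a1%:A; a2%:A; a3%:A]`_k.

Let grad : 'rV[B]_3 :=
  (r *: avec - rvec) *m (r^-1)%:M *m E^-1%:M
  - (hb%:A *: avec + 'i%:A *: crossv rvec avec) *m ((2 * hb)%:A / (r * c * E))%:M.

(** All fractions are brought to the common right factor [den^-1]. That factor then becomes a free
    letter, and each entry is a polynomial identity in the remaining letters, [r^-1] included. *)
Lemma qpartials_inv :
  is_qpartials hb c^-1 qD_inv ((- ('i * hb))%:A / (r * E)) grad.
Proof.
have invM u v : u \is a GRing.unit -> v \is a GRing.unit -> u * v = v * u ->
    (u * v)^-1 = u^-1 / v by move=> Uu Uv ->; rewrite invrM.
have den_unit : den \is a GRing.unit by rewrite unitrMr.
have cE : c * E = E * c by rewrite /E; move: c => c'; nc_alg C B tt; ring.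
have rc : r * c = c * r by rewrite /c mulrBr mulrBl r_comm_b.
have rE : r * E = E * r.
  by rewrite /E; move: c rc => c' rc; nc_alg C B (tt, rc); ring.
have defEV : E^-1 = c / den.
  by apply: (mulrI E_unit); rewrite divrr // mulrA -cE divrr.
have defcV : c^-1 = E / den by apply: (mulrI c_unit); rewrite divrr // mulrA divrr.
have defrEV : (r * E)^-1 = r^-1 * (c / den) by rewrite invM // defEV.
have defrcEV : (r * c * E)^-1 = r^-1 / den.
  by rewrite -mulrA -/den invM // /den mulrA rc -mulrA rE mulrA.
rewrite /is_qpartials defcV defrEV.
have [cr0 cr1 cr2] := crossvE rvec avec.
have gE k : grad 0 k = (r * avec 0 k - rvec 0 k) * r^-1 * (c / den)
    - (hb%:A * avec 0 k + 'i%:A * crossv rvec avec 0 k) * ((2 * hb)%:A * (r^-1 / den)).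
  have subE (u v : 'rV[B]_3) : (u - v) 0 k = u 0 k - v 0 k by rewrite !mxE.
  have linE p q (u v : 'rV[B]_3) : (p *: u + q *: v) 0 k = p * u 0 k + q * v 0 k.
    by rewrite !mxE.
  by rewrite /grad defEV defrcEV subE !row_mul_scalar linE subE [(r *: avec) 0 k]mxE.
rewrite !{}gE cr0 cr1 cr2 !mxE /= /qD_inv /qD_r /qD_b !mx2E.
rewrite /n0 /n1 /n2; move: den^-1 => d; rewrite /E /c /b.
(* The shift 2 / h in the hatted time derivative equals - i / hb; keeping it opaque with [hkap] as
   its only rule makes the coefficients polynomial, within reach of [ring]. *)
pose kap := 2 / hpar hb; rewrite -/kap.
have hkap : hb * kap = - 'i.
  by rewrite /kap /hpar; field: ii; rewrite hb_neq0 neq0Ci.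
move: kap hkap => kap hkap.
by congr mx2; move: r^-1 Vr rV Vx Vy Vz => s h1 h2 h3 h4 h5;
  nc_alg C B (tt, esym rx, esym ry, esym rz, h1, h2, h3, h4, h5); ring: hkap ii a3sq.
Qed.

(** The case of [inverse_of_difference] where [f] embeds [B] as scalar matrices and [k] is hb^2.
    Commutation of the two matrices is a premise, to be supplied by the multiplicativity of D. *)
Lemma qD_inv_is_inverse :
  qD_r *m qD_b = qD_b *m qD_r -> is_inverse_mx (qD_r - qD_b) qD_inv.
Proof.
move=> rb; have den_unit : den \is a GRing.unit by rewrite unitrMr.
have algC (u : B) (k : C) : u * k%:A = k%:A * u by nc_alg C B tt; ring.
have E4 : E = c ^+ 2 - 4 * (hb ^+ 2)%:A.
  by rewrite /E; move: c => c'; nc_alg C B tt; ring.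
move: (den_unit); rewrite /qD_inv /is_inverse_mx /den E4 => ?.
pose f : {rmorphism B -> 'M[B]_2} := scalar_mx.
apply: (@inverse_of_difference B _ f) => //.
- exact: r_comm_b.
- exact: qD_r_commr.
- exact: mx2_comm_alg.
- exact: qD_b_commr.
- exact: qD_b_commb.
- exact: mx2_comm_alg.
- exact: qD_r_sqr.
- exact: qD_b_sqr.
Qed.
End Derivations.

(** Linearity of a ring morphism follows from its values on scalars, since [k *: a] is the product
    [k%:A * a]. *)
Lemma rmorph_lincomb (C : numClosedFieldType) (F : lalgType C) (B : unitAlgType C)
    (D : {rmorphism F -> 'M[B]_2}) (u v w : F) (a1 a2 a3 : C) :
    (forall k : C, D k%:A = k%:A%:M) ->
  D (a1 *: u + a2 *: v + a3 *: w)
  = a1%:A%:M *m D u + a2%:A%:M *m D v + a3%:A%:M *m D w.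
Proof.
move=> DA; have DZ k a : D (k *: a) = k%:A%:M *m D a.
  by rewrite -[k *: a]mulr_algl rmorphM DA.
by rewrite 2!rmorphD !DZ.
Qed.

(** * The algebra A inside its skew field of fractions *)

Section QuantumDerivatives.
Variables (C : numClosedFieldType) (hb : C) (hb_neq0 : hb != 0).
Variables (B : unitAlgType C) (iota : {lrmorphism qA hb -> B}).

Let x := iota (qx hb).
Let y := iota (qy hb).
Let z := iota (qz hb).
Let r := iota (qr hb).

Lemma iota_relations :
  [/\ [/\ comm_br x y = hpar hb *: z, comm_br y z = hpar hb *: x
         & comm_br z x = hpar hb *: y],
      [/\ r * x = x * r, r * y = y * r & r * z = z * r]
    & x ^+ 2 + y ^+ 2 + z ^+ 2 + (hb ^+ 2)%:A = r ^+ 2].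
Proof.
have: forall s, s \in suq_relators hb x y z (iota (qt hb)) r -> s = 0.
  move=> s; rewrite -map_suq_relators => /mapP[u /qA_relations -> ->].
  by rewrite raddf0.
by case/suq_relatorsP.
Qed.

Lemma qr_comm (a1 a2 a3 : C) (b := a1 *: qx hb + a2 *: qy hb + a3 *: qz hb) :
  qr hb * b = b * qr hb.
Proof.
have [_ _ [rx ry rz] _] := suq_relatorsP (@qA_relations C hb).
exact (comm_lincomb (A := qA hb) a1 a2 a3 rx ry rz).
Qed.

Section FractionField.
Hypothesis B_frac : skew_field_of_fractions iota.

Let iota_unit a : a != 0 -> iota a \is a GRing.unit.
Proof.
case: B_frac => unitB iota_inj _ a0; apply: unitB.
by rewrite -(raddf0 iota) (inj_eq iota_inj).
Qed.

Lemma r_unit : r \is a GRing.unit.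
Proof.
apply: iota_unit; have := @qr_sub_neq0 C hb 0 0 0 0.
by rewrite !scale0r !addr0 subr0; apply.
Qed.

Lemma iota_sub_unit (k a1 a2 a3 : C) : hb + k != 0 ->
  r - (a1 *: x + a2 *: y + a3 *: z) + k%:A \is a GRing.unit.
Proof.
move=> /(@qr_sub_neq0 _ _ k a1 a2 a3) /iota_unit.
by rewrite map_affine addrAC.
Qed.

(** The element factors as (c + 2 hb)(c - 2 hb); the character gives the factors the nonzero values
    3 hb and - hb. *)
Lemma iota_quadric_unit (a1 a2 a3 : C) (c := r - (a1 *: x + a2 *: y + a3 *: z)) :
  c ^+ 2 - (4 * hb ^+ 2)%:A \is a GRing.unit.
Proof.
have -> : c ^+ 2 - (4 * hb ^+ 2)%:A = (c + (2 * hb)%:A) * (c + (- (2 * hb))%:A).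
  by move: c => c; nc_alg C B tt; ring.
rewrite unitrMr iota_sub_unit //.
- have -> : hb + - (2 * hb) = - hb by ring.
  by rewrite oppr_eq0.
- have -> : hb + 2 * hb = 3 * hb by ring.
  by rewrite mulf_neq0 // pnatr_eq0.
Qed.
End FractionField.

Variable D : {rmorphism qA hb -> 'M[B]_2}.
Hypothesis hD : is_qD iota D.

Lemma qD_rE : D (qr hb) = qD_r hb x y z r.
Proof. exact: D_r hD. Qed.

Lemma qD_bE (a1 a2 a3 : C) :
  D (a1 *: qx hb + a2 *: qy hb + a3 *: qz hb) = qD_b hb x y z a1 a2 a3.
Proof.
rewrite (rmorph_lincomb (F := qA hb)); last exact: D_scal hD.
rewrite (D_x hD) (D_y hD) (D_z hD) !mx2E -/x -/y -/z.
by rewrite /qD_b; congr mx2; nc_alg C B tt; ring.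
Qed.
End QuantumDerivatives.

(** * The inverse of D(c) and the derivatives of 1 / (r - b) *)

Theorem mainTheorem4 (R : realType) (hb : R[i]) (hb_neq0 : hb != 0)
    (B : unitAlgType R[i]) (iota : {lrmorphism qA hb -> B})
    (B_frac : skew_field_of_fractions iota)
    (D : {rmorphism qA hb -> 'M[B]_2}) (hD : is_qD iota D)
    (alpha : 'rV[R[i]]_3)
    (alpha1 : alpha 0 0 ^+ 2 + alpha 0 1 ^+ 2 + alpha 0 2 ^+ 2 = 1) :
  let bA : qA hb :=
    alpha 0 0 *: qx hb + alpha 0 1 *: qy hb + alpha 0 2 *: qz hb in
  let cA : qA hb := qr hb - bA in
  let r := iota (qr hb) in
  let b := iota bA in
  let den := (r - b) * ((r - b) ^+ 2 - (4 * hb ^+ 2)%:A) in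
  let a0 := 2 * (r ^+ 2 + b ^+ 2 - 3 * (b * r) - (hb ^+ 2)%:A) / den in
  let a1 := (3 * b - r) / den in
  let a2 := (3 * r - b) / den in
  let a3 := (- 2) / den in
  let rvec : 'rV[B]_3 :=
    \row_k [:: iota (qx hb); iota (qy hb); iota (qz hb)]`_k in
  let avec : 'rV[B]_3 := \row_k (alpha 0 k)%:A in
  [/\ D cA = D (qr hb) - D bA,
      is_inverse_mx (D cA)
        (a0%:M + D (qr hb) *m a1%:M + D bA *m a2%:M
         + D (qr hb) *m D bA *m a3%:M)
    & forall Dcinv : 'M[B]_2, is_inverse_mx (D cA) Dcinv ->
      forall (dt : B) (grad : 'rV[B]_3),
        is_qpartials hb (r - b)^-1 Dcinv dt grad <->
          dt = (- ('i * hb))%:A / (r * ((r - b) ^+ 2 - (4 * hb ^+ 2)%:A))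
          /\ grad =
             (r *: avec - rvec)
               *m (r^-1)%:M *m ((r - b) ^+ 2 - (4 * hb ^+ 2)%:A)^-1%:M
             - (hb%:A *: avec + 'i%:A *: crossv rvec avec)
               *m ((2 * hb)%:A
                   / (r * (r - b) * ((r - b) ^+ 2 - (4 * hb ^+ 2)%:A)))%:M].
Proof.
move=> bA cA r b den a0 a1 a2 a3 rvec avec.
have [[xy yz zx] [rx ry rz] cas] := iota_relations iota.
have def_b : b = alpha 0 0 *: iota (qx hb) + alpha 0 1 *: iota (qy hb)
               + alpha 0 2 *: iota (qz hb).
  exact: (map_lincomb iota).
have r_unit := r_unit hb_neq0 B_frac.
(* The shift 0 gives [c] itself, with character value [hb]. *)
have c_unit := @iota_sub_unit _ _ _ _ B_frac 0 (alpha 0 0) (alpha 0 1) (alpha 0 2).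
rewrite scale0r !addr0 in c_unit; have {}c_unit := c_unit hb_neq0.
have E_unit := iota_quadric_unit hb_neq0 B_frac (alpha 0 0) (alpha 0 1) (alpha 0 2).
have DcA : D cA = D (qr hb) - D bA by rewrite rmorphB.
have DrDb : D (qr hb) *m D bA = D bA *m D (qr hb).
  by rewrite -[LHS](rmorphM D) -[RHS](rmorphM D) qr_comm.
have inv_N := qD_inv_is_inverse xy yz zx rx ry rz cas r_unit alpha1 c_unit E_unit.
have part_N := qpartials_inv hb_neq0 rx ry rz r_unit alpha1 c_unit E_unit.
(* The explicit matrices are folded back into values of [D]. *)
rewrite /qD_inv -def_b -(qD_rE hD) -(qD_bE hD) -/bA in inv_N part_N.
have {}inv_N := inv_N DrDb; rewrite -DcA in inv_N.
split; [exact: DcA | exact: inv_N | move=> M [cM _] dt grad].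
move: inv_N part_N; set N := (X in is_inverse_mx _ X) => -[_ Nc] part_N.
(* Inverses are unique, so an arbitrary inverse of [D cA] is the explicit one. *)
have -> : M = N by rewrite -[LHS]mul1mx -Nc -mulmxA cM mulmx1.
apply: (qpartials_uniq _ _ hb_neq0).
have <- : \row_k [:: (alpha 0 0)%:A; (alpha 0 1)%:A; (alpha 0 2)%:A]`_k = avec.
  by apply: row3P; rewrite !mxE.
exact: part_N.
Qed.
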